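(* Let $G$ be a finite simple graph on $d$ vertices. For each acyclic orientation $\rho$ of $G$ fix a natural labeling of $\Pi_\rho$. Then, as formal power series in $q$, \[ P_G(q) \;=\; \frac{ q^d \sum_{(\rho,\sigma)} q^{ \operatorname{maj} \sigma^{\mathrm{op}} } }{ (1-q) (1-q^2) \cdots (1-q^d) } \;=\; \frac{ q^{ \binom{ d+1 } 2 } \sum_{(\rho,\sigma)} q^{ - \operatorname{maj} \sigma } }{ (1-q) (1-q^2) \cdots (1-q^d) }, \] where each sum ranges over all pairs of an acyclic orientation $\rho$ of $G$ and a linear extension $\sigma\in\mathcal{L}(\Pi_\rho)$.
   Context: For a graph $G=(V,E)$, a $G$-partition of $n\in\mathbb{Z}_{>0}$ is a tuple $m\in\mathbb{Z}_{>0}^V$ with $\sum_{v\in V}m_v=n$ and $m_v\ne m_w$ whenever $vw\in E$; $p_G(n)$ is the number of $G$-partitions of $n$ and $P_G(q):=\sum_{n>0}p_G(n)q^n$. $\Pi_\rho$ is the poset on $V$ with $u\preceq w$ iff there is a directed path (possibly of length 0) from $u$ to $w$ in $\rho$. A natural labeling of a $d$-element poset $\Pi$ is a bijection $\omega:\Pi\to[d]$ with $\omega(x)<\omega(y)$ whenever $x\prec y$; a linear extension $y_1,\dots,y_d$ (a listing with $y_i\prec y_j\Rightarrow i<j$) is identified with the permutation $\sigma=(\omega(y_1),\dots,\omega(y_d))$ of $[d]$, and $\mathcal{L}(\Pi)$ is the set of these. For a permutation $\sigma$ of $[d]$: $\operatorname{maj}\sigma=\sum_{j\in[d-1]:\,\sigma(j+1)<\sigma(j)}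 j$ and $\sigma^{\mathrm{op}}(j):=\sigma(d+1-j)$. *)

(* Defs.v *)
From HB Require Import structures.
From mathcomp Require Import all_boot all_order all_algebra all_fingroup.
From mathcomp Require Import boolp.

Set Implicit Arguments.
Unset Strict Implicit.
Unset Printing Implicit Defensive.

Import GRing.Theory.

Local Open Scope ring_scope.

(* The ring R[[q]]: a power series is its sequence of coefficients.  The
   record keeps the Cauchy product apart from pointwise structures on
   [nat -> R]. *)
Record fps (R : Type) := Fps { coefs : nat -> R }.
Arguments Fps {R} _.

Lemma fpsP (R : Type) (x y : fps R) :
  (forall n, coefs x n = coefs y n) -> x = y.
Proof. by case: x => f; case: y => g /= fg; congr Fps; apply: funext. Qed.

HB.instance Definition _ (R : Type) := gen_eqMixin (fps R).
HB.instance Definition _ (R : Type) := gen_choiceMixin (fps R).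

Definition fps_add (R : nmodType) (x y : fps R) : fps R :=
  Fps (fun n => coefs x n + coefs y n).
Definition fps_opp (R : zmodType) (x : fps R) : fps R :=
  Fps (fun n => - coefs x n).
Definition fps_const (R : nmodType) (c : R) : fps R :=
  Fps (fun n => if n == 0%N then c else 0).
Definition fps_mul (R : nzRingType) (x y : fps R) : fps R :=
  Fps (fun n => \sum_(i < n.+1) coefs x i * coefs y (n - i)).

Lemma fps_addA (R : zmodType) : associative (@fps_add R).
Proof. by move=> x y z; apply: fpsP => n /=; rewrite addrA. Qed.
Lemma fps_addC (R : zmodType) : commutative (@fps_add R).
Proof. by move=> x y; apply: fpsP => n /=; rewrite addrC. Qed.
Lemma fps_add0 (R : zmodType) : left_id (fps_const 0) (@fps_add R).
Proof. by move=> x; apply: fpsP => n /=; rewrite if_same add0r. Qed.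
Lemma fps_addN (R : zmodType) :
  left_inverse (fps_const 0) (@fps_opp R) (@fps_add R).
Proof. by move=> x; apply: fpsP => n /=; rewrite if_same addNr. Qed.

HB.instance Definition _ (R : zmodType) :=
  GRing.isZmodule.Build (fps R) (@fps_addA R) (@fps_addC R) (@fps_add0 R)
    (@fps_addN R).

Definition fps_trunc (R : nzRingType) (n : nat) (x : fps R) : {poly R} :=
  \poly_(i < n.+1) coefs x i.

Lemma coef_fps_trunc (R : nzRingType) (n : nat) (x : fps R) (k : nat) :
  (k <= n)%N -> (fps_trunc n x)`_k = coefs x k.
Proof. by move=> kn; rewrite coef_poly ltnS kn. Qed.

Lemma coef_fps_mul (R : nzRingType) (n : nat) (x y : fps R) (k : nat) :
  (k <= n)%N ->
  coefs (fps_mul x y) k = (fps_trunc n x * fps_trunc n y)`_k.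
Proof.
move=> kn; rewrite coefM; apply: eq_bigr => i _.
have ik : (i <= k)%N by rewrite -ltnS.
by rewrite !coef_fps_trunc ?(leq_trans _ kn) // leq_subr.
Qed.

Lemma fps_mulA (R : nzRingType) : associative (@fps_mul R).
Proof.
move=> x y z; apply: fpsP => n.
transitivity ((fps_trunc n x * (fps_trunc n y * fps_trunc n z))`_n).
  rewrite coefM; apply: eq_bigr => i _.
  have ik : (i <= n)%N by rewrite -ltnS.
  by rewrite coef_fps_trunc // (@coef_fps_mul _ n) // leq_subr.
rewrite mulrA coefM; apply: eq_bigr => i _.
have ik : (i <= n)%N by rewrite -ltnS.
by rewrite coef_fps_trunc ?leq_subr // -coef_fps_mul.
Qed.

Lemma fps_mulC (R : comNzRingType) : commutative (@fps_mul R).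
Proof. by move=> x y; apply: fpsP => n; rewrite !(@coef_fps_mul _ n) // mulrC. Qed.

Lemma fps_mul1 (R : nzRingType) : left_id (fps_const 1) (@fps_mul R).
Proof.
move=> x; apply: fpsP => n /=.
rewrite big_ord_recl /= mul1r subn0 big1 ?addr0 // => i _.
by rewrite mul0r.
Qed.

Lemma fps_mulr1 (R : nzRingType) : right_id (fps_const 1) (@fps_mul R).
Proof.
move=> x; apply: fpsP => n /=.
rewrite big_ord_recr /= subnn eqxx mulr1 big1 ?add0r // => i _.
by rewrite subn_eq0 leqNgt ltn_ord mulr0.
Qed.

Lemma fps_mulDl (R : nzRingType) : left_distributive (@fps_mul R) +%R.
Proof.
move=> x y z; apply: fpsP => n /=; rewrite -big_split /=.
by apply: eq_bigr => i _; rewrite mulrDl.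
Qed.

Lemma fps_mulDr (R : nzRingType) : right_distributive (@fps_mul R) +%R.
Proof.
move=> x y z; apply: fpsP => n /=; rewrite -big_split /=.
by apply: eq_bigr => i _; rewrite mulrDr.
Qed.

Lemma fps_1_neq0 (R : nzRingType) : fps_const 1 != 0 :> fps R.
Proof.
by apply/eqP => /(congr1 (fun x => coefs x 0%N)) /= /eqP; rewrite oner_eq0.
Qed.

HB.instance Definition _ (R : nzRingType) :=
  GRing.Zmodule_isNzRing.Build (fps R) (@fps_mulA R) (@fps_mul1 R)
    (@fps_mulr1 R) (@fps_mulDl R) (@fps_mulDr R) (@fps_1_neq0 R).

HB.instance Definition _ (R : comNzRingType) :=
  GRing.PzRing_hasCommutativeMul.Build (fps R) (@fps_mulC R).

(* The first n coefficients of 1/x, when the constant term of x is a unit. *)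
Fixpoint fps_inv_rec (R : unitRingType) (x : fps R) (n : nat) : seq R :=
  if n is k.+1 then
    let s := fps_inv_rec x k in
    rcons s ((coefs x 0%N)^-1 *
             ((k == 0%N)%:R - \sum_(i < k) s`_i * coefs x (k - i)))
  else [::].

Definition fps_unit (R : unitRingType) : {pred fps R} :=
  fun x => coefs x 0%N \is a GRing.unit.

Definition fps_inv (R : unitRingType) (x : fps R) : fps R :=
  if fps_unit x then Fps (fun n => (fps_inv_rec x n.+1)`_n) else x.

Lemma size_fps_inv_rec (R : unitRingType) (x : fps R) (n : nat) :
  size (fps_inv_rec x n) = n.
Proof. by elim: n => //= n IH; rewrite size_rcons IH. Qed.

Lemma nth_fps_inv_rec (R : unitRingType) (x : fps R) (n i : nat) :
  (i < n)%N -> (fps_inv_rec x n)`_i = (fps_inv_rec x i.+1)`_i.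
Proof.
elim: n => // n IH; rewrite ltnS leq_eqVlt => /predU1P[-> //|lt_in].
by rewrite -IH //= nth_rcons size_fps_inv_rec lt_in.
Qed.

Lemma fps_mulVx (R : comUnitRingType) :
  {in @fps_unit R, left_inverse 1 (@fps_inv R) *%R}.
Proof.
move=> x ux; have {}ux : fps_unit x := ux.
rewrite /fps_inv ux; apply: fpsP => n.
rewrite [LHS]/= big_ord_recr subnn.
rewrite nth_rcons size_fps_inv_rec ltnn eqxx mulrAC mulVr // mul1r.
rewrite (eq_bigr (fun i : 'I_n =>
  (fps_inv_rec x n)`_i * coefs x (n - i))); last first.
  by move=> i _; rewrite [in RHS]nth_fps_inv_rec.
by rewrite /= addrC subrK; case: (n == 0%N).
Qed.

Lemma fps_unitPl (R : comUnitRingType) (x y : fps R) :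
  y * x = 1 -> fps_unit x.
Proof.
move=> /(congr1 (fun z => coefs z 0%N)) /=; rewrite big_ord1 /= => yx1.
by apply/unitrPr; exists (coefs y 0%N); rewrite mulrC.
Qed.

Lemma fps_invr_out (R : comUnitRingType) :
  {in [predC @fps_unit R], @fps_inv R =1 id}.
Proof.
move=> x; rewrite inE => nux; rewrite /fps_inv.
by have /negbTE -> : ~~ fps_unit x := nux.
Qed.

HB.instance Definition _ (R : comUnitRingType) :=
  GRing.ComNzRing_hasMulInverse.Build (fps R) (@fps_mulVx R) (@fps_unitPl R)
    (@fps_invr_out R).

Lemma fps_integral (R : idomainType) (x y : fps R) :
  x * y = 0 -> (x == 0) || (y == 0).
Proof.
have nz (z : fps R) : z != 0 -> exists n, coefs z n != 0.
  move=> /eqP z0; apply: contrapT => /forallNP z00; apply: z0.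
  apply: fpsP => n /=; rewrite if_same; apply/eqP; apply/negPn/negP.
  exact: z00.
move=> xy0; apply/norP => -[/nz xn /nz yn].
case: (ex_minnP xn) => i xi mini; case: (ex_minnP yn) => j yj minj.
move: xy0 => /(congr1 (fun z => coefs z (i + j)%N)) /=; rewrite if_same => /eqP.
have li : (i < (i + j).+1)%N by rewrite ltnS leq_addr.
rewrite (bigD1 (Ordinal li)) //= addKn big1 ?addr0.
  by rewrite mulf_eq0 (negbTE xi) (negbTE yj).
move=> k; rewrite -val_eqE neq_ltn /= => /orP[ki|ik].
  have [->|/mini] := eqVneq (coefs x k) 0; first by rewrite mul0r.
  by rewrite leqNgt ki.
have [->|/minj] := eqVneq (coefs y (i + j - k)) 0; first by rewrite mulr0.
have kij : (k <= i + j)%N by rewrite -ltnS.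
by rewrite leqNgt ltn_subLR // ltn_add2r ik.
Qed.

HB.instance Definition _ (R : idomainType) :=
  GRing.ComUnitRing_isIntegral.Build (fps R) (@fps_integral R).

Definition fpsX (R : nzRingType) : fps R := Fps (fun n => (n == 1%N)%:R).

(* The simple graph on T with adjacency relation e, assumed symmetric and
   irreflexive where it matters. *)
Definition Gpartition (T : finType) (e : rel T) (n : nat) (m : T -> nat) :
    bool :=
  [&& [forall v, (0 < m v)%N], (\sum_(v : T) m v)%N == n &
      [forall v, forall w, e v w ==> (m v != m w)]].

Lemma Gpartition_le (T : finType) (e : rel T) (n : nat) (m : T -> nat)
    (v : T) : Gpartition e n m -> (m v <= n)%N.
Proof. by case/and3P => _ /eqP <- _; rewrite (bigD1 v) //= leq_addr. Qed.

(* By Gpartition_le, bounding the parts by n loses no G-partition of n; it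
   only makes the type being counted finite. *)
Definition nb_Gpartitions (T : finType) (e : rel T) (n : nat) : nat :=
  #|[set m : {ffun T -> 'I_n.+1} | Gpartition e n (fun v => m v : nat)]|.

Definition Gpartition_series (T : finType) (e : rel T) : fps int :=
  Fps (fun n => if (0 < n)%N then (nb_Gpartitions e n)%:Z else 0).

(* An orientation is given by its set of arcs: (u, v) \in rho means that the
   edge uv is directed from u to v. *)
Definition arc (T : finType) (rho : {set T * T}) : rel T :=
  fun u v => (u, v) \in rho.

Definition orientation (T : finType) (e : rel T) (rho : {set T * T}) : bool :=
  [forall u, forall v, (arc rho u v ==> e u v) &&
                       (e u v ==> (arc rho u v (+) arc rho v u))].

Definition acyclic (T : finType) (rho : {set T * T}) : Prop :=
  forall c : seq T, ucycle (arc rho) c -> c = [::].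

Definition acyclic_orientation (T : finType) (e : rel T)
    (rho : {set T * T}) : bool :=
  orientation e rho && `[< acyclic rho >].

(* The order of the poset Pi_rho: [connect] is reachability by a directed
   path, possibly of length 0. *)
Definition poset_le (T : finType) (rho : {set T * T}) : rel T :=
  connect (arc rho).

Definition strict (T : eqType) (le : rel T) : rel T :=
  fun x y => (x != y) && le x y.

(* Here and below [d] is represented by 'I_d = {0, ..., d-1}, i.e. both labels
   and positions are shifted down by one. *)
Definition natural_labeling (T : finType) (le : rel T) (omega : T -> 'I_#|T|) :
    Prop :=
  bijective omega /\ forall x y, strict le x y -> (omega x < omega y)%N.

(* Since d = #|T|, an injective y : 'I_d -> T lists every element once. *)
Definition linear_extension (T : finType) (le : rel T)
    (y : {ffun 'I_#|T| -> T}) : bool :=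
  injectiveb y && [forall i, forall j, strict le (y i) (y j) ==> (i < j)%N].

Definition linear_extensions (T : finType) (le : rel T)
    (omega : T -> 'I_#|T|) : {set 'S_#|T|} :=
  [set s : 'S_#|T| | [exists y : {ffun 'I_#|T| -> T},
     linear_extension le y && [forall i, s i == omega (y i)]]].

(* A descent between the 0-based positions i and i+1 has 1-based position
   i+1, which is what it contributes. *)
Definition maj (d : nat) (s : 'S_d) : nat :=
  (\sum_(i < d) \sum_(j < d | (j == i.+1 :> nat) && (s j < s i)) i.+1)%N.

Definition op_perm (d : nat) (s : 'S_d) : 'S_d :=
  perm (inj_comp (@perm_inj _ s) (@rev_ord_inj d)).

Definition orientation_extension (T : finType) (e : rel T)
    (omega : {set T * T} -> T -> 'I_#|T|) (p : {set T * T} * 'S_#|T|) : bool :=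
  acyclic_orientation e p.1 &&
  (p.2 \in linear_extensions (poset_le p.1) (omega p.1)).

(* Main.v *)
Require Import Defs.
From mathcomp Require Import all_boot all_order all_algebra all_fingroup.
From mathcomp Require Import boolp.
From mathcomp Require Import ring zify.

(* Stanley's theory of P-partitions.  Order the vertices by increasing value of
   a G-partition [m], breaking ties by decreasing label: [m] then determines a
   unique pair of an acyclic orientation (every edge points to the larger value)
   and a linear extension [s] of it.  For fixed [s] the values of [m], read in
   this order, form a positive weakly increasing sequence that jumps at the
   ascents of [s]; the excesses of its consecutive differences over these forced
   jumps are arbitrary natural numbers, the excess at position [i] (from 0)
   being counted in the last [d - i] values.  Summing gives
   [q ^ (d + maj (op s)) / \prod_i (1 - q ^ (d - i))].
   The second formula is the first one for the reversed orientations, labels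
   and linear extensions, which exchange ascents and descents. *)

Set Implicit Arguments.
Unset Strict Implicit.
Unset Printing Implicit Defensive.

Import GRing.Theory.

(** * Sorting permutations *)

(** Ties go by decreasing label because natural labels increase along arcs: a tie along an arc would
    list its head before its tail. In a listing that extends the orientation, every arc therefore
    forces a strict increase of [m]. *)
Definition key_lt (T : Type) (d : nat) (m : T -> nat) (w : T -> 'I_d) : rel T :=
  fun u v => (m u < m v) || (m u == m v) && (w v < w u).

(** [(s^-1)%g (w u)] is the position of [u] in the listing encoded by [s]. For injective [w] the
    order [key_lt m w] is total, so the implication is then an equivalence. *)
Definition sorts (T : finType) (d : nat) (m : T -> nat) (w : T -> 'I_d)
    (s : 'S_d) : bool :=
  [forall u, forall v,
     ((s^-1)%g (w u) < (s^-1)%g (w v)) ==> key_lt m w u v].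

Section Sorting.

Variables (T : finType) (m : T -> nat) (w : T -> 'I_#|T|).
Hypothesis w_inj : injective w.

Local Notation key := (key_lt m w).
Local Notation rank v := #|[set u | key u v]|.

Lemma key_lt_trans : transitive key.
Proof. rewrite /key_lt => v u x; lia. Qed.

Lemma key_lt_irr v : key v v = false.
Proof. rewrite /key_lt; lia. Qed.

Lemma key_lt_total u v : u != v -> key u v || key v u.
Proof.
move=> uv; have : w u != w v by rewrite (inj_eq w_inj).
rewrite -val_eqE /key_lt /=; lia.
Qed.

Lemma rank_lt v : rank v < #|T|.
Proof.
suff: rank v < #|[set: T]| by rewrite cardsT.
apply: proper_card; rewrite properT.
by apply/negP => /eqP/setP/(_ v); rewrite !inE key_lt_irr.
Qed.

Lemma rank_homo u v : key u v -> rank u < rank v.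
Proof.
move=> uv; apply: proper_card; apply/properP; split.
  by apply/subsetP => x; rewrite !inE => /key_lt_trans; apply.
by exists u; rewrite !inE ?key_lt_irr.
Qed.

Lemma rank_mono u v : (rank u < rank v) = key u v.
Proof.
apply/idP/idP => [uv|/rank_homo //].
have [euv|nuv] := eqVneq u v; first by rewrite euv ltnn in uv.
by case/orP: (key_lt_total nuv) => // /rank_homo; lia.
Qed.

(** Positions form a bijection onto the ordinals that carries [key_lt] to [<], so the vertices below
    [v] fill exactly the positions before that of [v]. Hence [m] and [w] determine [s]. *)
Lemma sorts_rank s v : sorts m w s -> (s^-1)%g (w v) = rank v :> nat.
Proof.
move=> /forallP ms; pose pos u := (s^-1)%g (w u).
have pos_inj : injective pos by move=> x y /perm_inj/w_inj.
have posE x y : key x y = (pos x < pos y).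
  apply/idP/idP => [xy|pxy]; last by have /forallP/(_ y)/implyP := ms x; apply.
  rewrite ltnNge leq_eqVlt; apply/negP => /orP[/eqP/val_inj/pos_inj exy|yx].
    by rewrite exy key_lt_irr in xy.
  have /forallP/(_ x)/implyP/(_ yx) := ms y.
  by move=> /key_lt_trans/(_ xy); rewrite key_lt_irr.
have pos_bij : bijective pos by apply: inj_card_bij; rewrite ?card_ord.
rewrite -(card_imset _ pos_inj) -[LHS]/(pos v : nat).
have -> : pos @: [set u | key u v] = [set i : 'I__ | i < pos v].
  apply/setP => i; rewrite inE; apply/imsetP/idP => [[u]|iv].
    by rewrite inE posE => ? ->.
  case: pos_bij => g gK Kg.
  by exists (g i); rewrite ?inE ?posE ?Kg.
rewrite cardsE -sum1_card (eq_bigl (fun i : 'I_#|T| => i < pos v)) //.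
rewrite (big_ord_narrow (ltnW (ltn_ord (pos v)))) /=.
by rewrite sum1_card card_ord.
Qed.

Lemma sorts_uniq s t : sorts m w s -> sorts m w t -> s = t.
Proof.
move=> ms mt; apply: invg_inj; apply/permP => i.
have [g gK Kg] : bijective w by apply: inj_card_bij; rewrite ?card_ord.
by apply: val_inj; rewrite /= -(Kg i) !sorts_rank.
Qed.

Lemma sorts_exists : exists s, sorts m w s.
Proof.
have [g gK Kg] : bijective w by apply: inj_card_bij; rewrite ?card_ord.
have p_inj : injective (fun i => Ordinal (rank_lt (g i))).
  move=> i j /(congr1 val) /= rij; apply: (can_inj Kg).
  apply/eqP/negPn/negP => /key_lt_total.
  by rewrite -!rank_mono rij ltnn.
(* [p_inj] sends a label to the rank of its vertex, that is, to its position; [s] goes from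
   positions to labels, hence the inverse. *)
exists (perm p_inj)^-1%g; apply/forallP => u; apply/forallP => v.
by rewrite invgK !permE /= !gK rank_mono; apply/implyP.
Qed.

End Sorting.

(** * Sequences sorted by a permutation *)

(** With [x i] the value at the vertex in position [i], whose label is [s i], this is positivity
    together with [sorts] read along positions. *)
Definition sorted_by (d : nat) (s : 'S_d) (x : 'I_d -> nat) : bool :=
  [forall i, 0 < x i] &&
  [forall i : 'I_d, forall j : 'I_d,
     (i < j) ==> ((x i < x j) || (x i == x j) && (s j < s i))].

(* The least possible value of [x i - x i.-1] (of [x 0] if [i = 0]) when
   [sorted_by s x]. *)
Definition jump (d : nat) (s : 'S_d) (i : 'I_d) : nat :=
  (i == 0 :> nat) + \sum_(k < d | (i == k.+1 :> nat) && (s k < s i)) 1.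

(** Sums constrained by [i == l.+1] encode a value at the predecessor of [i], and are empty at
    [i = 0]. *)
Lemma big_ord_pred (d : nat) (F : 'I_d -> nat) (i k : 'I_d) (P : pred 'I_d) :
  i = k.+1 :> nat ->
  \sum_(l < d | (i == l.+1 :> nat) && P l) F l = if P k then F k else 0.
Proof.
move=> ik; have E (l : 'I_d) : (i == l.+1 :> nat) = (l == k).
  by rewrite ik eqSS eq_sym.
case: ifP => Pk; [apply: big_pred1 | apply: big_pred0] => l; rewrite E.
  by have [->|/negPf nlk] := eqVneq l k; rewrite /= ?eqxx ?Pk ?nlk.
by have [->|] := eqVneq l k.
Qed.

Lemma jump0 (d : nat) (s : 'S_d) (i : 'I_d) : i = 0 :> nat -> jump s i = 1.
Proof. by move=> i0; rewrite /jump i0 big1 // => k; rewrite i0. Qed.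

Lemma jumpS (d : nat) (s : 'S_d) (i k : 'I_d) :
  i = k.+1 :> nat -> jump s i = (s k < s i).
Proof.
move=> ik; rewrite /jump (big_ord_pred (fun=> 1) (fun l => s l < s i) ik).
by rewrite ik; case: ifP.
Qed.

(** The forced jump at position 0 contributes [d]. An ascent of [s] from [i - 1] to [i] contributes
    [d - i], which is the 1-based position of the corresponding descent of [op_perm s]. *)
Lemma sum_jump (d : nat) (s : 'S_d) :
  0 < d -> \sum_(i < d) (d - i) * jump s i = d + maj (op_perm s).
Proof.
move=> d_gt0; rewrite /jump; under eq_bigr do rewrite mulnDr big_distrr /=.
rewrite big_split /=; congr (_ + _).
  rewrite (bigD1 (Ordinal d_gt0)) //= muln1 subn0 big1 ?addn0 // => i.
  by rewrite -val_eqE /= => /negPf->; rewrite muln0.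
rewrite /maj (reindex_inj rev_ord_inj) /=; apply: eq_bigr => i _.
rewrite [RHS](reindex_inj rev_ord_inj) /=; apply: eq_big => [k|k _].
  rewrite !permE /= rev_ordK; congr (_ && _).
  have := ltn_ord i; have := ltn_ord k; lia.
have := ltn_ord i; lia.
Qed.

(** * Partial sums and excesses *)

Definition psum (d : nat) (F : 'I_d -> nat) (i : 'I_d) : nat :=
  \sum_(j < d | j <= i) F j.

Lemma psum0 (d : nat) (F : 'I_d -> nat) (i : 'I_d) :
  i = 0 :> nat -> psum F i = F i.
Proof.
move=> i0; apply: big_pred1 => j /=; rewrite -val_eqE /= i0; lia.
Qed.

Lemma psumS (d : nat) (F : 'I_d -> nat) (i k : 'I_d) :
  i = k.+1 :> nat -> psum F i = F i + psum F k.
Proof.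
move=> ik; rewrite /psum (bigD1 i) //=; congr (_ + _).
apply: eq_bigl => j; rewrite -val_eqE /=; lia.
Qed.

Lemma ord_succ_ind (d : nat) (P : 'I_d -> Prop) :
  (forall i : 'I_d, i = 0 :> nat -> P i) ->
  (forall i k : 'I_d, i = k.+1 :> nat -> P k -> P i) -> forall i, P i.
Proof.
move=> P0 PS [i lti]; elim: i lti => [|i IH] lti; first exact: P0.
by apply: (PS _ (Ordinal (ltnW lti))) => //; exact: IH.
Qed.

Lemma psum_inj (d : nat) (F G : 'I_d -> nat) : psum F =1 psum G -> F =1 G.
Proof.
move=> FG; apply: ord_succ_ind => [i i0|i k ik _].
  by have := FG i; rewrite !psum0.
by have := FG i; rewrite !(psumS _ ik) FG => /addIn.
Qed.

Lemma sum_psum (d : nat) (F : 'I_d -> nat) :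
  \sum_i psum F i = \sum_(i < d) (d - i) * F i.
Proof.
rewrite /psum (exchange_big_dep predT) //=; apply: eq_bigr => j _.
rewrite sum_nat_cond_const; congr (_ * _).
rewrite (eq_card (B := ~: [set i : 'I_d | i < j])); last first.
  by move=> i; rewrite !inE -leqNgt.
rewrite cardsCs setCK card_ord; congr (_ - _).
rewrite cardsE -sum1_card (eq_bigl (fun i : 'I_d => i < j)) //.
by rewrite (big_ord_narrow (ltnW (ltn_ord j))) /= sum1_card card_ord.
Qed.

Lemma sorted_by_psum (d : nat) (s : 'S_d) (c : 'I_d -> nat) :
  sorted_by s (psum (fun i => c i + jump s i)).
Proof.
set x := psum _; apply/andP; split; apply/forallP => i.
  elim/ord_succ_ind: i => [i i0|i k ik].
    by rewrite /x psum0 ?jump0 // addn1.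
  by rewrite /x (psumS _ ik) => ?; rewrite ltn_addl.
apply/forallP; apply: ord_succ_ind => [j ->|j k jk IH] //.
apply/implyP; rewrite jk ltnS /x (psumS _ jk) -/x (jumpS s jk) leq_eqVlt.
(* If [i] is the predecessor [k] of [j], an ascent makes the jump 1 and the increase strict, while a
   descent permits a tie. If [i < k], the comparison passes through [k]. *)
have [/val_inj -> _|nik /= ik] := eqVneq (i : nat) k.
  rewrite -/x; have : s j != s k.
    by rewrite (inj_eq perm_inj) -val_eqE /= jk; lia.
  by rewrite -val_eqE /=; case: (ltnP (s k) (s j)) => /=; lia.
have {}IH := implyP IH ik.
rewrite -/x; case: (ltnP (s k) (s j)) => /=; lia.
Qed.

Lemma sorted_by_step (d : nat) (s : 'S_d) (x : 'I_d -> nat) (i k : 'I_d) :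
  sorted_by s x -> i = k.+1 :> nat -> x k + jump s i <= x i.
Proof.
move=> /andP[_ /forallP/(_ k)/forallP/(_ i)/implyP sx] ik.
have := sx; rewrite ik ltnSn => /(_ isT).
rewrite (jumpS s ik); case: (ltnP (s k) (s i)) => /=; lia.
Qed.

Lemma sorted_by_is_psum (d : nat) (s : 'S_d) (x : 'I_d -> nat) :
  sorted_by s x ->
  exists2 c, (forall i, c i <= x i) & x =1 psum (fun i => c i + jump s i).
Proof.
(* The sum is [x] at the predecessor of [i], or 0 at the start. The truncated subtractions are exact
   by [sorted_by_step] and, at 0, by positivity. *)
move=> sx; pose c i := x i - jump s i - \sum_(k < d | i == k.+1 :> nat) x k.
exists c => [i|]; first by rewrite /c; lia.
apply: ord_succ_ind => [i i0|i k ik xk].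
  rewrite psum0 // /c jump0 // big1 => [|k]; last by rewrite i0.
  by have /andP[/forallP/(_ i) ? _] := sx; lia.
rewrite (psumS _ ik) -xk /c.
have := big_ord_pred x predT ik; under eq_bigl do rewrite andbT.
by move=> ->; have := sorted_by_step sx ik => /=; lia.
Qed.

Lemma card_sorted_by (d : nat) (s : 'S_d) (n : nat) :
  0 < d ->
  #|[set x : {ffun 'I_d -> 'I_n.+1} |
      (\sum_i x i == n) && sorted_by s (fun i => x i)]| =
  #|[set c : {ffun 'I_d -> 'I_n.+1} |
      d + maj (op_perm s) + \sum_(i < d) (d - i) * c i == n]|.
Proof.
move=> d_gt0; pose f (c : {ffun 'I_d -> 'I_n.+1}) i :=
  psum (fun i => c i + jump s i) i.
have sum_f c :
    \sum_i f c i = d + maj (op_perm s) + \sum_(i < d) (d - i) * c i.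
  rewrite sum_psum -sum_jump // -big_split /=.
  by apply: eq_bigr => i _; rewrite mulnDr addnC.
(* [inord] keeps the value only below [n.+1]; on [C] this holds because each [f c i] is at most the
   total [n]. *)
pose phi c : {ffun 'I_d -> 'I_n.+1} := [ffun i => inord (f c i)].
set X := [set x | _]; set C := [set c | _].
have phiE c : c \in C -> forall i, phi c i = f c i :> nat.
  rewrite inE -sum_f => /eqP fn i; rewrite ffunE inordK // ltnS -fn.
  by rewrite (bigD1 i) //= leq_addr.
suff -> : X = phi @: C.
  apply: card_in_imset => c c' cC c'C cc'.
  have /psum_inj E : f c =1 f c' by move=> i; rewrite -!phiE // cc'.
  by apply/ffunP => i; apply/val_inj/(@addIn (jump s i))/E.
apply/setP => x; apply/idP/imsetP => [|[c cC ->]].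
  rewrite inE => /andP[/eqP xn /sorted_by_is_psum[c cx xc]].
  pose c' : {ffun 'I_d -> 'I_n.+1} := [ffun i => inord (c i)].
  have xf i : x i = f c' i :> nat.
    rewrite xc; apply: eq_bigr => j _; rewrite ffunE inordK //.
    by rewrite (leq_ltn_trans (cx j)).
  have cC : c' \in C.
    by rewrite inE -sum_f -[X in _ == X]xn; apply/eqP/eq_bigr => i _.
  by exists c' => //; apply/ffunP => i; apply: val_inj; rewrite /= phiE.
rewrite inE (eq_bigr (f c)) => [|i _]; last exact: phiE.
move: (cC); rewrite inE -sum_f => -> /=.
have := sorted_by_psum s (fun i => c i); congr (is_true (_ && _)).
  by apply: eq_forallb => i; rewrite phiE.
by apply: eq_forallb => i; apply: eq_forallb => j; rewrite !phiE.
Qed.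

(** * G-partitions, acyclic orientations and linear extensions *)

(** Composing with the bijection [pos] from vertices to positions turns sequences into vertex
    functions and preserves the sum. *)
Lemma card_sorts (T : finType) (w : T -> 'I_#|T|) (s : 'S_#|T|) (n : nat) :
  bijective w ->
  #|[set m : {ffun T -> 'I_n.+1} |
      [&& [forall v, 0 < m v], \sum_v m v == n & sorts (fun v => m v) w s]]| =
  #|[set x : {ffun 'I_#|T| -> 'I_n.+1} |
      (\sum_i x i == n) && sorted_by s (fun i => x i)]|.
Proof.
move=> [g wK gK]; pose pos v := (s^-1)%g (w v); pose y i := g (s i).
have posK : cancel pos y by move=> v; rewrite /y permKV wK.
have yK : cancel y pos by move=> i; rewrite /pos gK permK.
pose h (x : {ffun 'I_#|T| -> 'I_n.+1}) : {ffun T -> 'I_n.+1} :=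
  [ffun v => x (pos v)].
have h_bij : bijective h.
  exists (fun m : {ffun T -> 'I_n.+1} => [ffun i => m (y i)]) => x;
    apply/ffunP => i;
    by rewrite !ffunE ?yK ?posK.
rewrite -(on_card_preimset (onW_bij _ h_bij)); apply: eq_card => x.
rewrite !inE /sorted_by andbCA; congr [&& _ == n, _ & _].
- rewrite [RHS](reindex pos) /=; last by exists y => ? _.
  by apply: eq_bigr => v _; rewrite ffunE.
- apply/forallP/forallP => H v; last by rewrite ffunE.
  by have := H (y v); rewrite ffunE yK.
- apply/forallP/forallP => H u; apply/forallP => v.
    have /forallP/(_ (y v)) := H (y u).
    by rewrite /key_lt !ffunE !yK !gK !permK.
  have /forallP/(_ (pos v)) := H (pos u).
  by rewrite /key_lt !ffunE -/(pos u) -/(pos v) /pos !permKV.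
Qed.

(** A bijective labeling leaves only one candidate listing, [g (s i)] with [g] inverse to [w], so
    the existential becomes a condition on positions. *)
Lemma mem_linear_extensions (T : finType) (le : rel T) (w : T -> 'I_#|T|)
    (s : 'S_#|T|) :
  bijective w ->
  (s \in linear_extensions le w) =
  [forall u, forall v,
     strict le u v ==> ((s^-1)%g (w u) < (s^-1)%g (w v))].
Proof.
move=> [g wK gK]; rewrite inE; apply/existsP/forallP => [[y]|H].
  case/andP => /andP[_ /forallP ley] /forallP sy u; apply/forallP => v.
  have yE x : y ((s^-1)%g (w x)) = x.
    by apply: (can_inj wK); rewrite -(eqP (sy _)) permKV.
  have /forallP/(_ ((s^-1)%g (w v))) := ley ((s^-1)%g (w u)).
  by rewrite !yE.
exists [ffun i => g (s i)]; apply/andP; split; last first.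
  by apply/forallP => i; rewrite ffunE gK.
apply/andP; split.
  apply/injectiveP => i j; rewrite !ffunE => /(can_inj gK); exact: perm_inj.
apply/forallP => i; apply/forallP => j; rewrite !ffunE.
by have /forallP/(_ (g (s j))) := H (g (s i)); rewrite !gK !permK.
Qed.

(** * The orientation induced by vertex values *)

Definition up_orientation (T : finType) (e : rel T) (m : T -> nat) :
    {set T * T} :=
  [set a | e a.1 a.2 && (m a.1 < m a.2)].

Section Orientations.

Variables (T : finType) (e : rel T) (omega : {set T * T} -> T -> 'I_#|T|).
Hypotheses (e_sym : symmetric e) (e_irr : irreflexive e).
Hypothesis omegaP : forall rho, acyclic_orientation e rho ->
  natural_labeling (poset_le rho) (omega rho).

Local Notation proper m := [forall v, forall w, e v w ==> (m v != m w)].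

Lemma up_orientation_path (m : T -> nat) (u : T) (p : seq T) :
  path (Defs.arc (up_orientation e m)) u p -> path (fun x y => m x < m y) u p.
Proof. by apply: sub_path => x y; rewrite /Defs.arc inE => /andP[]. Qed.

Lemma values_lt_trans (m : T -> nat) : transitive (fun x y => m x < m y).
Proof. by move=> y x z; exact: ltn_trans. Qed.

Lemma acyclic_up_orientation (m : T -> nat) :
  proper m -> acyclic_orientation e (up_orientation e m).
Proof.
move=> /forallP mP; apply/andP; split.
  apply/forallP => u; apply/forallP => v; rewrite /Defs.arc !inE /=.
  apply/andP; split; first by apply/implyP => /andP[].
  apply/implyP => uv; rewrite [e v u]e_sym uv /=.
  by have /forallP/(_ v) := mP u; rewrite uv /=; case: ltngtP.
apply/asboolP => -[|x c] // /andP[/up_orientation_path xc _].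
have /allP/(_ x) := order_path_min (@values_lt_trans m) xc.
by rewrite mem_rcons mem_head ltnn => /(_ isT).
Qed.

Lemma up_orientation_le (m : T -> nat) (u v : T) :
  strict (poset_le (up_orientation e m)) u v -> m u < m v.
Proof.
case/andP => uv /connectP[p /up_orientation_path + vp].
case: p vp => [vu|x p vp ux]; first by rewrite vu eqxx in uv.
have /allP -> // := order_path_min (@values_lt_trans m) ux.
by rewrite vp /= mem_last.
Qed.

Lemma extension_sorts_up (p : {set T * T} * 'S_#|T|) (m : T -> nat) :
  orientation_extension e omega p -> sorts m (omega p.1) p.2 ->
  proper m /\ p.1 = up_orientation e m.
Proof.
case: p => rho s /andP[/= rhoP sP] /forallP ms.
have [w_bij w_mono] := omegaP rhoP.
move: sP; rewrite mem_linear_extensions // => /forallP sP.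
have /andP[/forallP orho _] := rhoP.
have arcE u v : Defs.arc rho u v -> e u v.
  by have /forallP/(_ v)/andP[/implyP] := orho u.
have arc_lt u v : Defs.arc rho u v -> m u < m v.
  move=> uv; have suv : strict (poset_le rho) u v.
    rewrite /strict /poset_le connect1 // andbT.
    by apply: contraTneq (arcE _ _ uv) => ->; rewrite e_irr.
  have /forallP/(_ v)/implyP/(_ suv) luv := sP u.
  have /forallP/(_ v)/implyP/(_ luv) := ms u.
  (* A tie would require [v] to have the smaller label, against naturality along the arc from [u] to
     [v]. *)
  by case/orP => // /andP[_]; rewrite ltnNge ltnW ?w_mono.
have eP u v : e u v -> Defs.arc rho u v || Defs.arc rho v u.
  move=> uv; have /forallP/(_ v)/andP[_ /implyP/(_ uv)] := orho u.
  by case: (Defs.arc rho u v).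
split.
  apply/forallP => u; apply/forallP => v; apply/implyP => /eP.
  by case/orP => /arc_lt; rewrite neq_ltn => ->; rewrite ?orbT.
apply/setP => -[u v]; rewrite inE /= -[LHS]/(Defs.arc rho u v).
apply/idP/andP => [uv|[/eP/orP[//|/arc_lt]]]; first by rewrite arcE ?arc_lt.
by move=> /ltnW; rewrite leqNgt => /negPf->.
Qed.

Lemma sorts_up_extension (m : T -> nat) (s : 'S_#|T|) :
  proper m -> sorts m (omega (up_orientation e m)) s ->
  orientation_extension e omega (up_orientation e m, s).
Proof.
move=> mP ms; have uP := acyclic_up_orientation mP.
have [w_bij w_mono] := omegaP uP.
rewrite /orientation_extension uP /= mem_linear_extensions //.
apply/forallP => u; apply/forallP => v; apply/implyP => /up_orientation_le uv.
have w_inj := bij_inj w_bij.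
by rewrite !(sorts_rank w_inj _ ms) rank_homo // /key_lt uv.
Qed.

(** Each proper [m] is sorted by exactly one pair, since its orientation must be
    [up_orientation e m] and its sorting permutation is then unique; an improper [m] is sorted by
    none. *)
Lemma count_extension_sorts (m : T -> nat) :
  \sum_(p | orientation_extension e omega p) sorts m (omega p.1) p.2 =
  proper m.
Proof.
rewrite -big_mkcondr /=; case: (boolP (proper m)) => mP; last first.
  apply: big_pred0 => p; apply/negP => /andP[pP /(extension_sorts_up pP)].
  by rewrite (negPf mP) => -[].
have [w_bij _] := omegaP (acyclic_up_orientation mP).
have w_inj := bij_inj w_bij.
have [s ms] := sorts_exists m w_inj.
rewrite (big_pred1 (up_orientation e m, s)) // => -[rho t] /=.
apply/andP/eqP => [[pP pm]|[-> ->]]; last first.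
  by split; first exact: sorts_up_extension.
have [_ /= rhoE] := extension_sorts_up pP pm.
by rewrite rhoE in pm *; rewrite (sorts_uniq w_inj pm ms).
Qed.

Lemma nb_Gpartitions_extensions (n : nat) :
  nb_Gpartitions e n =
  \sum_(p | orientation_extension e omega p)
    #|[set m : {ffun T -> 'I_n.+1} | [&& [forall v, 0 < m v], \sum_v m v == n
        & sorts (fun v => m v) (omega p.1) p.2]]|.
Proof.
under eq_bigr do rewrite -sum1_card big_mkcond.
rewrite exchange_big /nb_Gpartitions -sum1_card big_mkcond /=.
apply: eq_bigr => m _; rewrite inE /Gpartition.
under [RHS]eq_bigr do rewrite inE.
case: [forall v, _] => /=; last by rewrite big1.
case: (_ == n) => /=; last by rewrite big1.
exact: esym (count_extension_sorts (fun v => m v)).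
Qed.

End Orientations.

(** * Reversal *)

Definition rev_arcs (T : finType) (rho : {set T * T}) : {set T * T} :=
  [set a | (a.2, a.1) \in rho].

Lemma rev_arcsK (T : finType) : involutive (@rev_arcs T).
Proof. by move=> rho; apply/setP => -[u v]; rewrite !inE. Qed.

Lemma arc_rev_arcs (T : finType) (rho : {set T * T}) (u v : T) :
  Defs.arc (rev_arcs rho) u v = Defs.arc rho v u.
Proof. by rewrite /Defs.arc inE. Qed.

Lemma acyclic_rev_arcs (T : finType) (rho : {set T * T}) :
  acyclic rho -> acyclic (rev_arcs rho).
Proof.
move=> rhoP c /andP[cc uc]; apply: (can_inj revK); apply: rhoP.
rewrite /ucycle rev_uniq uc andbT rev_cycle.
rewrite (eq_cycle (e' := Defs.arc (rev_arcs rho))) // => u v.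
by rewrite arc_rev_arcs.
Qed.

Lemma acyclic_orientation_rev_arcs (T : finType) (e : rel T)
    (rho : {set T * T}) :
  symmetric e ->
  acyclic_orientation e (rev_arcs rho) = acyclic_orientation e rho.
Proof.
move=> e_sym; congr (_ && _); last first.
  apply/asboolP/asboolP => /acyclic_rev_arcs //; by rewrite rev_arcsK.
apply/forallP/forallP => H u; apply/forallP => v;
  by have /forallP/(_ u) := H v; rewrite !arc_rev_arcs e_sym.
Qed.

Lemma poset_le_rev_arcs (T : finType) (rho : {set T * T}) (u v : T) :
  poset_le (rev_arcs rho) u v = poset_le rho v u.
Proof.
rewrite /poset_le; have /= <- := connect_rev (Defs.arc rho) u v.
by apply: eq_connect => x y; rewrite arc_rev_arcs.
Qed.

Lemma strict_rev_arcs (T : finType) (rho : {set T * T}) (u v : T) :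
  strict (poset_le (rev_arcs rho)) u v = strict (poset_le rho) v u.
Proof. by rewrite /strict poset_le_rev_arcs eq_sym. Qed.

Lemma flip_perm_subproof (d : nat) (s : 'S_d) :
  injective (fun i => rev_ord (s (rev_ord i))).
Proof. by move=> i j /rev_ord_inj/perm_inj/rev_ord_inj. Qed.

(** The reverse-complement of [s]: the listing is read backwards and the labels are complemented. *)
Definition flip_perm (d : nat) (s : 'S_d) : 'S_d :=
  perm (@flip_perm_subproof d s).

Lemma flip_permE (d : nat) (s : 'S_d) (i : 'I_d) :
  flip_perm s i = rev_ord (s (rev_ord i)).
Proof. by rewrite permE. Qed.

Lemma flip_permK (d : nat) : involutive (@flip_perm d).
Proof. by move=> s; apply/permP => i; rewrite !flip_permE !rev_ordK. Qed.

Lemma flip_permV (d : nat) (s : 'S_d) (i : 'I_d) :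
  (flip_perm s)^-1%g (rev_ord i) = rev_ord (s^-1%g i).
Proof.
apply: (@perm_inj _ (flip_perm s)).
by rewrite permKV flip_permE rev_ordK permKV.
Qed.

Lemma ltn_rev_ord (d : nat) (i j : 'I_d) : (rev_ord i < rev_ord j) = (j < i).
Proof. have := ltn_ord i; have := ltn_ord j; rewrite /=; lia. Qed.

(** [op_perm (flip_perm s)] is the complement of [s], so its descents are the ascents of [s] at the
    same positions. The two [maj] together add up all positions from 1 to [d - 1]. *)
Lemma maj_op_flip_perm (d : nat) (s : 'S_d) :
  d + maj (op_perm (flip_perm s)) + maj s = 'C(d.+1, 2).
Proof.
have opE (t : 'S_d) i : op_perm t i = t (rev_ord i) by rewrite permE.
rewrite binS bin1 -addnA addnC; congr (_ + _).
rewrite -bin2_sum big_mkord /maj -big_split /=.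
transitivity (\sum_(i < d) \sum_(j < d | j == i.+1 :> nat) i.+1).
  apply: eq_bigr => i _; rewrite [RHS](bigID (fun j : 'I_d => s i < s j)) /=.
  congr (_ + _); apply: eq_bigl => j; case: eqP => //= ji.
    by rewrite !opE !flip_permE !rev_ordK ltn_rev_ord.
  have : s j != s i by rewrite (inj_eq perm_inj) -val_eqE /= ji gtn_eqF.
  by rewrite -val_eqE /=; case: ltngtP.
rewrite (exchange_big_dep predT) //=; apply: eq_bigr => -[[|j] jd] _ /=.
  by apply: big_pred0.
pose k := Ordinal (ltnW jd); pose j' := Ordinal jd.
have jk : j' = k.+1 :> nat by [].
apply: etrans (big_ord_pred (fun i : 'I_d => i.+1) predT jk).
by apply: eq_bigl => i; rewrite andbT.
Qed.

(** Complementing the labels chosen for the reversed orientation gives a natural labeling of [rho]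
    itself, matched to [flip_perm]. *)
Definition rev_omega (T : finType) (omega : {set T * T} -> T -> 'I_#|T|)
    (rho : {set T * T}) (v : T) : 'I_#|T| :=
  rev_ord (omega (rev_arcs rho) v).

Section Reversal.

Variables (T : finType) (e : rel T) (omega : {set T * T} -> T -> 'I_#|T|).
Hypothesis e_sym : symmetric e.
Hypothesis omegaP : forall rho, acyclic_orientation e rho ->
  natural_labeling (poset_le rho) (omega rho).

Lemma rev_omega_natural (rho : {set T * T}) :
  acyclic_orientation e rho ->
  natural_labeling (poset_le rho) (rev_omega omega rho).
Proof.
rewrite -acyclic_orientation_rev_arcs // => /omegaP[w_bij w_mono].
split; first by apply: (bij_comp (inv_bij (@rev_ordK _)) w_bij).
by move=> u v; rewrite -strict_rev_arcs ltn_rev_ord; exact: w_mono.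
Qed.

Lemma orientation_extension_rev (p : {set T * T} * 'S_#|T|) :
  orientation_extension e (rev_omega omega) (rev_arcs p.1, flip_perm p.2) =
  orientation_extension e omega p.
Proof.
rewrite /orientation_extension /= acyclic_orientation_rev_arcs //.
case: (boolP (acyclic_orientation e p.1)) => //= pP.
have [w_bij _] := omegaP pP.
have [w'_bij _] : natural_labeling (poset_le (rev_arcs p.1))
    (rev_omega omega (rev_arcs p.1)).
  by apply: rev_omega_natural; rewrite acyclic_orientation_rev_arcs.
rewrite !mem_linear_extensions //.
apply/forallP/forallP => H u; apply/forallP => v; have /forallP/(_ u) := H v;
  by rewrite strict_rev_arcs /rev_omega rev_arcsK !flip_permV ltn_rev_ord.
Qed.

End Reversal.

(** * Power series *)

Local Open Scope ring_scope.

Lemma coefs_sum (R : zmodType) (I : Type) (r : seq I) (P : pred I)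
    (F : I -> fps R) (n : nat) :
  coefs (\sum_(i <- r | P i) F i) n = \sum_(i <- r | P i) coefs (F i) n.
Proof.
by apply: (big_morph (fun x => coefs x n)) => [x y|] //=; rewrite if_same.
Qed.

Lemma coefs_fpsXM (R : nzRingType) (x : fps R) (n : nat) :
  coefs (fpsX R * x) n = if n is k.+1 then coefs x k else 0.
Proof.
case: n => [|k] /=; first by rewrite big_ord1 /= mul0r.
rewrite big_ord_recl mul0r add0r big_ord_recl /= mul1r subSS subn0.
by rewrite big1 ?addr0 // => i _; rewrite mul0r.
Qed.

Lemma coefs_fpsXn (R : nzRingType) (k n : nat) :
  coefs (fpsX R ^+ k) n = (n == k)%:R.
Proof.
elim: k n => [|k IH] n; first by rewrite expr0 /=; case: eqP.
by rewrite exprS coefs_fpsXM; case: n.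
Qed.

Lemma coefs_fpsXnM_lt (R : nzRingType) (x : fps R) (k n : nat) :
  (n < k)%N -> coefs (fpsX R ^+ k * x) n = 0.
Proof.
elim: k n => // k IH n nk; rewrite exprS -mulrA coefs_fpsXM.
by case: n nk => // n; exact: IH.
Qed.

Lemma unit_1subXn (R : comUnitRingType) (k : nat) :
  (0 < k)%N -> 1 - fpsX R ^+ k \is a GRing.unit.
Proof.
case: k => // k _; suff /eqP H : coefs (1 - fpsX R ^+ k.+1) 0 = 1.
  change (coefs (1 - fpsX R ^+ k.+1) 0 \is a GRing.unit).
  by rewrite (eqP H) unitr1.
have /= -> := coefs_fpsXn R k.+1 0.
by rewrite subr0.
Qed.

(* Modulo [q ^ n.+1] each factor of the denominator is inverted by its
   geometric series cut after [n.+1] terms. *)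
Lemma coefs_Xn_div_prod (R : comUnitRingType) (I : finType) (w : I -> nat)
    (a n : nat) :
  (forall i, 0 < w i)%N ->
  coefs (fpsX R ^+ a / \prod_i (1 - fpsX R ^+ w i)) n =
  #|[set c : {ffun I -> 'I_n.+1} | a + \sum_i w i * c i == n]%N|%:R.
Proof.
move=> w_gt0; set q := fpsX R; set Z := \prod_i _.
pose G := \prod_i \sum_(c < n.+1) q ^+ (w i * c).
have uZ : Z \is a GRing.unit.
  by apply: rpred_prod => i _; exact: unit_1subXn.
(* Being 1 modulo [q ^+ n.+1] is stable under products, so it is enough to treat each factor. *)
have [z ZG] : exists z, Z * G = 1 + q ^+ n.+1 * z.
  rewrite -big_split /=.
  apply: (big_ind (fun x => exists z, x = 1 + q ^+ n.+1 * z)).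
  - by exists 0; rewrite mulr0 addr0.
  - move=> _ _ [x ->] [y ->]; exists (x + y + q ^+ n.+1 * x * y).
    ring.
  (* The geometric sum leaves [1 - q ^+ (w i * n.+1)]; one factor [q ^+ n.+1] is split off, which
     uses [0 < w i]. *)
  - move=> i _; exists (- q ^+ (n.+1 * (w i).-1)).
    rewrite (eq_bigr (fun c : 'I_n.+1 => (q ^+ w i) ^+ c)); last first.
      by move=> c _; rewrite exprM.
    rewrite -opprB mulNr -subrX1 opprB mulrN -exprD -exprM -mulnS prednK //.
    by rewrite mulnC.
transitivity (coefs (q ^+ a * G) n).
  have -> : q ^+ a * G = q ^+ a / Z + q ^+ n.+1 * (q ^+ a * (Z^-1 * z)).
    by rewrite -[G](mulKr uZ) ZG; ring.
  rewrite -[LHS]addr0.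
  by rewrite -[in LHS](coefs_fpsXnM_lt (q ^+ a * (Z^-1 * z)) (ltnSn n)).
rewrite /G bigA_distr_bigA mulr_sumr coefs_sum -sum1_card natr_sum.
rewrite big_mkcond [RHS]big_mkcond; apply: eq_bigr => c _.
by rewrite inE prodrXr -exprD coefs_fpsXn eq_sym; case: eqP.
Qed.

(** * The generating function of G-partitions *)

Lemma Gpartition_series_extensions (T : finType) (e : rel T)
    (omega : {set T * T} -> T -> 'I_#|T|) :
  (0 < #|T|)%N -> symmetric e -> irreflexive e ->
  (forall rho : {set T * T}, acyclic_orientation e rho ->
     natural_labeling (poset_le rho) (omega rho)) ->
  let q : fps int := fpsX int in
  Gpartition_series e =
    q ^+ #|T| * (\sum_(p | orientation_extension e omega p)
                   q ^+ maj (op_perm p.2))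
    / \prod_(1 <= i < #|T|.+1) (1 - q ^+ i).
Proof.
move=> T_gt0 e_sym e_irr omegaP q; apply: fpsP => n.
have -> : \prod_(1 <= i < #|T|.+1) (1 - q ^+ i) =
    \prod_(i < #|T|) (1 - q ^+ (#|T| - i)).
  rewrite big_add1 big_mkord (reindex_inj rev_ord_inj) /=.
  by apply: eq_bigr => i _; rewrite subnSK.
rewrite mulr_sumr mulr_suml coefs_sum.
transitivity ((nb_Gpartitions e n)%:R : int).
  (* The series has constant term 0 by definition, which agrees with the count because a nonempty
     graph has no partition of 0 into positive parts. *)
  case: n => [|n]; last by rewrite natz.
  suff -> : nb_Gpartitions e 0 = 0%N by [].
  apply/eqP; rewrite cards_eq0; apply/eqP/setP => m; rewrite !inE.
  apply/negP => /and3P[/forallP m_gt0 + _]; have [v _] := card_gt0P T_gt0.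
  by rewrite (bigD1 v) //= addn_eq0 eqn0Ngt m_gt0.
rewrite (nb_Gpartitions_extensions e_sym e_irr omegaP) natr_sum.
apply: eq_bigr => p /andP[/omegaP[w_bij _] _].
rewrite card_sorts // card_sorted_by // -exprD coefs_Xn_div_prod //.
by move=> i; rewrite subn_gt0.
Qed.

Theorem theorem30 (T : finType) (e : rel T)
    (omega : {set T * T} -> T -> 'I_#|T|) :
  (0 < #|T|)%N -> symmetric e -> irreflexive e ->
  (forall rho : {set T * T}, acyclic_orientation e rho ->
     natural_labeling (poset_le rho) (omega rho)) ->
  let d := #|T| in
  let q : fps int := fpsX int in
  let qF : {fraction (fps int)} := tofrac q in
  Gpartition_series e =
    q ^+ d * (\sum_(p : {set T * T} * 'S_d | orientation_extension e omega p)
                q ^+ maj (op_perm p.2))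
    / \prod_(1 <= i < d.+1) (1 - q ^+ i)
  /\
  tofrac (Gpartition_series e) =
    qF ^+ 'C(d.+1, 2) *
      (\sum_(p : {set T * T} * 'S_d | orientation_extension e omega p)
         qF ^- maj p.2)
    / \prod_(1 <= i < d.+1) (1 - qF ^+ i).
Proof.
move=> T_gt0 e_sym e_irr omegaP d q qF.
split; first exact: Gpartition_series_extensions.
have qF_neq0 : qF != 0.
  rewrite tofrac_eq0; apply/eqP => /(congr1 (fun x => coefs x 1)) /= /eqP.
  by rewrite oner_eq0.
(* The series does not depend on the labelings, so the first formula may be used with
   [rev_omega omega]. *)
rewrite (Gpartition_series_extensions T_gt0 e_sym e_irr
  (rev_omega_natural e_sym omegaP)) -/d -/q.
rewrite rmorphM rmorphV; last first.
  rewrite big_seq; apply: rpred_prod => i.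
  rewrite mem_index_iota => /andP[i0 _].
  exact: unit_1subXn.
congr (_ / _); last first.
  rewrite rmorph_prod; apply: eq_bigr => i _.
  by rewrite rmorphB rmorph1 rmorphXn.
rewrite !mulr_sumr rmorph_sum.
have flipK : involutive
    (fun p : {set T * T} * 'S_d => (rev_arcs p.1, flip_perm p.2)).
  by case=> rho s /=; rewrite rev_arcsK flip_permK.
rewrite (reindex_inj (can_inj flipK)) /=.
apply: eq_big => [p|p _]; first exact: orientation_extension_rev.
(* After reindexing by the reversal the exponent is [d + maj (op_perm (flip_perm p.2))], the
   difference of ['C(d.+1, 2)] and [maj p.2]; the negative power cancels since [qF] is nonzero. *)
rewrite -exprD rmorphXn /= -(maj_op_flip_perm p.2) // [in RHS]exprD.
by rewrite mulfK // expf_neq0.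
Qed.
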